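(* Let $X_t$ be a regular one-dimensional diffusion as in the context, let $g:D\to\mathbb{R}$ satisfy $g(x_0)>0$ for some $x_0\in(l,r)$, let $\rho>0$, and put $h(p)=g(p)/\psi(p)$ for $p\in(l,r)$. Let $p^*\in(l,r)$. The threshold stopping time $\tau^l_{p^*}$ is optimal in the problem $$\sup_{\tau\in\mathcal{M}^l_{\rm th}}\mathbf{E}^x g(X_\tau)e^{-\rho\tau}\mathbf{1}_{\{\tau<\infty\}}$$ for all $x\in(l,r)$ if and only if the following two conditions hold (for $p\in(l,r)$): 1. $h(p)\le h(p^* )$ whenever $p<p^*$; 2. $h(p)$ does not increase (i.e. is non-increasing) for $p\ge p^*$.
   Context: $X_t$, $t\ge0$, is a (continuous) diffusion process with values in an interval $D\subseteq\mathbb{R}$ with boundary points $-\infty\le l<r\le+\infty$ (each endpoint may or may not belong to $D$), with infinitesimal generator $\mathbb{L}f(x)=a(x)f'(x)+\frac12\sigma^2(x)f''(x)$, where $a:D\to\mathbb{R}$, $\sigma:D\to\mathbb{R}_+$. Regularity is guaranteed by the assumption: for every $x\in(l,r)$ there is $\varepsilon>0$ with $\int_{x-\varepsilon}^{x+\varepsilon}\frac{1+|a(y)|}{\sigma^2(y)}dy<\infty$. $\mathbf{E}^x$ denotes expectation for $X_0=x$. $\psi$ and $\varphi$ denote the increasing and the decreasing fundamental solutions (positive and finite on $(l,r)$, with absolutely continuous derivatives, unique up to positive multiplicative constants) of $\mathbb{L}u=\rho u$ a.e. on $(l,r)$ associated with the process $X$; with $T_p=\inf\{t\ge0:X_t=p\}$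 they satisfy $\mathbf{E}^xe^{-\rho T_p}=\psi(x)/\psi(p)$ for $x<p$ and $\mathbf{E}^xe^{-\rho T_p}=\varphi(x)/\varphi(p)$ for $x\ge p$ ($x,p\in(l,r)$). For $p\in(l,r)$, $\tau_p^l=\inf\{t\ge0: X_t\ge p\}$, and $\mathcal{M}^l_{\rm th}=\{\tau^l_p:\ p\in(l,r)\}$ is the class of threshold stopping times. *)

(* Defs.v *)
From HB Require Import structures.
From mathcomp Require Import all_boot all_order all_algebra.
From mathcomp Require Import all_classical all_reals all_analysis.
From mathcomp Require Import measurable_realfun.
Set Implicit Arguments.
Unset Strict Implicit.
Unset Printing Implicit Defensive.
Import Order.TTheory GRing.Theory Num.Theory.
Import numFieldNormedType.Exports.
Local Open Scope ring_scope.
Local Open Scope classical_set_scope.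

(* Coefficients, pay-offs and other functions on D or on
   (l, r) are total functions R -> R of which only the values on D, resp.
   (l, r), are ever constrained.  Times are real numbers t with 0 <= t. *)

Definition open_itv (R : realType) (l r : \bar R) : set R :=
  [set x | (l < x%:E)%E /\ (x%:E < r)%E].

Definition state_interval (R : realType) (l r : \bar R) (D : set R) : Prop :=
  [/\ (l < r)%E, open_itv l r `<=` D &
      forall x, D x -> (l <= x%:E)%E /\ (x%:E <= r)%E].

Definition absolutely_continuous (R : realType) (c d : R) (f : R -> R) : Prop :=
  forall eps : R, 0 < eps -> exists2 delta : R, 0 < delta &
    forall (n : nat) (u v : 'I_n -> R),
      (forall i, [/\ c <= u i, u i <= v i & v i <= d]) ->
      (forall i j, i != j -> v i <= u j \/ v j <= u i) ->
      \sum_(i < n) (v i - u i) < delta ->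
      \sum_(i < n) `|f (v i) - f (u i)| < eps.

Definition has_ac_derivative (R : realType) (l r : \bar R) (f : R -> R) : Prop :=
  (forall x, open_itv l r x -> derivable f x 1) /\
  (forall c d, open_itv l r c -> open_itv l r d ->
     absolutely_continuous c d (derive1 f)).

(* Pointwise value of the differential expression; when f' is absolutely
   continuous it is meaningful almost everywhere. *)
Definition diff_op (R : realType) (a sigma f : R -> R) (x : R) : R :=
  a x * derive1 f x + 2^-1 * sigma x ^+ 2 * derive1 (derive1 f) x.

(* The division is that of \bar R, where 1 / 0 = +oo, so that the condition
   does force sigma <> 0 almost everywhere. *)
Definition locally_integrable_coefficients (R : realType) (l r : \bar R)
    (a sigma : R -> R) : Prop :=
  forall x, open_itv l r x -> exists eps : R,
    [/\ 0 < eps, `[x - eps, x + eps] `<=` open_itv l r &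
        (\int[lebesgue_measure]_(y in `[(x - eps)%R, (x + eps)%R])
           ((1 + `|a y|)%:E / (sigma y ^+ 2)%:E) < +oo)%E].

Section process.
Context (R : realType) (d : measure_display) (Omega : measurableType d).
Implicit Types (X : R -> Omega -> R) (P : R -> probability Omega R).
Implicit Types tau : Omega -> \bar R.

Definition natural_filtration X (t : R) : set (set Omega) :=
  <<s [set A | exists (s : R) (B : set R),
         [/\ 0 <= s, s <= t, measurable B & A = X s @^-1` B]] >>.

Definition stopping_time X tau : Prop :=
  (forall w, 0 <= tau w)%E /\
  (forall t, 0 <= t -> natural_filtration X t [set w | (tau w <= t%:E)%E]).

Definition stopped_events X tau (A : set Omega) : Prop :=
  forall t, 0 <= t ->
    natural_filtration X t (A `&` [set w | (tau w <= t%:E)%E]).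

(* P x is the law under which X starts from x.  The single-time form below
   yields the one for finite-dimensional distributions, by iteration over the
   stopping times tau + t. *)
Definition strong_Markov (D : set R) P X : Prop :=
  forall (x : R) tau (A : set Omega) (t : R) (B : set R),
    D x -> stopping_time X tau -> stopped_events X tau A -> 0 <= t ->
    measurable B ->
    P x (A `&` [set w | (tau w < +oo)%E]
           `&` [set w | B (X (fine (tau w) + t) w)]) =
    (\int[P x]_(w in A `&` [set w | tau w < +oo])
       P (X (fine (tau w)) w) (X t @^-1` B))%E.

(* u is the value at f of the infinitesimal generator of the semigroup
   f |-> (x |-> E^x f (X_t)), as a uniform limit on D. *)
Definition in_generator (D : set R) P X (f u : R -> R) : Prop :=
  forall eps : R, 0 < eps -> \forall t \near 0^'+, forall x, D x ->
    `|(fine ('E_(P x)[fun w => f (X t w)]) - f x) / t - u x| < eps.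

(* The generator acts as diff_op on the functions supported by a compact
   subset of (l, r).  Since a and sigma are merely measurable, diff_op a sigma f
   is only determined almost everywhere, and the functions for which it has a
   continuous version u are the ones that belong to the domain.  The behaviour
   at endpoints belonging to D is left free. *)
Definition has_generator (l r : \bar R) (D : set R) (a sigma : R -> R) P X
    : Prop :=
  forall f u : R -> R,
    has_ac_derivative l r f -> continuous u ->
    (exists c e : R, [/\ open_itv l r c, open_itv l r e &
       forall x, ~ (c <= x <= e) -> f x = 0 /\ u x = 0]) ->
    {ae lebesgue_measure, forall x, open_itv l r x -> diff_op a sigma f x = u x} ->
    in_generator D P X f u.

Record regular_diffusion (l r : \bar R) (D : set R) (a sigma : R -> R) P X
    : Prop := RegularDiffusion {
  diffusion_interval : state_interval l r D ;
  diffusion_drift : measurable_fun D a ;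
  diffusion_volatility : measurable_fun D sigma ;
  diffusion_volatility_ge0 : forall x, D x -> 0 <= sigma x ;
  diffusion_regularity : locally_integrable_coefficients l r a sigma ;
  diffusion_measurable : forall t : R, 0 <= t -> measurable_fun setT (X t) ;
  diffusion_state : forall (t : R) (w : Omega), 0 <= t -> D (X t w) ;
  diffusion_continuous :
    forall w, {within `[0, +oo[, continuous (fun t => X t w)} ;
  diffusion_start : forall x, D x -> P x [set w | X 0 w = x] = 1%E ;
  diffusion_kernel : forall (t : R) (B : set R), 0 <= t -> measurable B ->
    measurable_fun D (fun x => P x (X t @^-1` B)) ;
  diffusion_Markov : strong_Markov D P X ;
  diffusion_generator : has_generator l r D a sigma P X
}.

Definition hitting_time X (p : R) : Omega -> \bar R :=
  fun w => ereal_inf [set t%:E | t in [set t : R | 0 <= t /\ X t w = p]].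

Definition threshold_time X (p : R) : Omega -> \bar R :=
  fun w => ereal_inf [set t%:E | t in [set t : R | 0 <= t /\ p <= X t w]].

Definition threshold_times (l r : \bar R) X : set (Omega -> \bar R) :=
  [set threshold_time X p | p in open_itv l r].

(* exp (- rho tau) 1_{tau < oo} *)
Definition discount (rho : R) (tau : \bar R) : R :=
  if tau is t%:E then expR (- (rho * t)) else 0.

Definition expected_payoff (rho : R) (g : R -> R) P X (x : R) tau : \bar R :=
  ('E_(P x)[fun w => (g (X (fine (tau w)) w) * discount rho (tau w))%R])%E.

Definition optimal_in (M : set (Omega -> \bar R)) (rho : R) (g : R -> R) P X
    (x : R) tau : Prop :=
  M tau /\
  expected_payoff rho g P X x tau =
    ereal_sup [set expected_payoff rho g P X x tau' | tau' in M].

(* The increasing fundamental solution associated with the process.  The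
   equation alone does not determine it when l is an accessible endpoint: it is
   tied to the behaviour of X at l by the Laplace transforms of the hitting
   times, which fix psi up to a positive multiplicative constant. *)
Record increasing_fundamental_solution (l r : \bar R) (a sigma : R -> R)
    (rho : R) P X (psi : R -> R) : Prop := IncreasingFundamentalSolution {
  fundamental_gt0 : forall x, open_itv l r x -> 0 < psi x ;
  fundamental_increasing : forall x y, open_itv l r x -> open_itv l r y ->
    x < y -> psi x < psi y ;
  fundamental_ac : has_ac_derivative l r psi ;
  fundamental_equation : {ae lebesgue_measure, forall x, open_itv l r x ->
    diff_op a sigma psi x = rho * psi x} ;
  fundamental_hitting : forall x p, open_itv l r x -> open_itv l r p -> x < p ->
    ('E_(P x)[fun w => discount rho (hitting_time X p w)])%E =
      (psi x / psi p)%:E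
}.

End process.

(* Main.v *)
(* A path started at x < p first reaches [p, +oo) exactly at p, so waiting for
   p is worth g p * psi x / psi p = h p * psi x; a path started at x >= p stops
   at once and earns g x = h x * psi x.  In both cases the value of the
   threshold p is h (max x p) * psi x with psi x > 0, so pstar is optimal for all x
   iff h (max x p) <= h (max x pstar) for all x and p.  The case x = p < pstar is
   the first condition, the case pstar <= x <= p the second, and every other case
   reduces to one of these. *)
Require Import Defs.
From HB Require Import structures.
From mathcomp Require Import all_boot all_order all_algebra.
From mathcomp Require Import all_classical all_reals all_analysis.
From mathcomp Require Import measurable_realfun.
Import Order.TTheory GRing.Theory Num.Theory.
Import numFieldNormedType.Exports.
Local Open Scope ring_scope.
Local Open Scope classical_set_scope.
Set Implicit Arguments.
Unset Strict Implicit.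

(* The pay-off g is arbitrary, so the discounted pay-off need not be measurable
   off the almost sure event [X 0 = x]: the library's ae_eq_integral does not
   apply to it. *)
Section ae_nonmeasurable.
Local Open Scope ereal_scope.
Context (d : measure_display) (T : measurableType d) (R : realType)
  (mu : {measure set T -> \bar R}).

(** The integral of a nonnegative function is a supremum over the nonnegative simple functions below
    it, and those below [f] are also below [g]. *)
Lemma nonmeasurable_ge0_le_integral (f g : T -> \bar R) :
  (forall x, 0 <= f x) -> (forall x, f x <= g x) ->
  \int[mu]_x f x <= \int[mu]_x g x.
Proof.
move=> f0 fg; have g0 x : 0 <= g x by exact: le_trans (fg x).
rewrite !ge0_integralTE//; apply: le_ereal_sup => _ [h /= hf <-].
by exists h => // x; exact: le_trans (fg x).
Qed.

(** A sandwich: [f] lies between two measurable functions that equal [g] on [A] and are constantly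
    [0], resp. [+oo], off [A]. Both integrate to the integral of [g] because the complement of [A]
    is null. *)
Lemma nonmeasurable_ge0_integral_eq (A : set T) (f g : T -> \bar R) :
  measurable A -> mu (~` A) = 0 -> measurable_fun setT g ->
  (forall x, 0 <= f x) -> (forall x, 0 <= g x) -> {in A, f =1 g} ->
  \int[mu]_x f x = \int[mu]_x g x.
Proof.
move=> mA A0 mg f0 g0 fg.
have mif (c : \bar R) : measurable_fun setT (fun x => if x \in A then g x else c).
  by apply: measurable_fun_ifT => //; apply: (measurable_fun_bool true);
    rewrite setTI preimage_mem_true.
have intif c : \int[mu]_x (if x \in A then g x else c) = \int[mu]_x g x.
  apply: ae_eq_integral => //; exists (~` A); split => //; first exact: measurableC.
  by move=> x /= H Ax; apply: H => _; rewrite mem_set.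
apply/eqP; rewrite eq_le -{1}(intif +oo) -(intif 0).
apply/andP; split; apply: nonmeasurable_ge0_le_integral => //= x;
  case: ifPn => //.
- by move=> /fg ->.
- by rewrite leey.
- by move=> /fg ->.
Qed.

Lemma nonmeasurable_integral_eq (A : set T) (f g : T -> \bar R) :
  measurable A -> mu (~` A) = 0 -> measurable_fun setT g -> {in A, f =1 g} ->
  \int[mu]_x f x = \int[mu]_x g x.
Proof.
move=> mA A0 mg fg; rewrite [LHS]integralE [RHS]integralE.
congr (_ - _); apply: (@nonmeasurable_ge0_integral_eq A) => //.
- exact: measurable_funepos.
- by move=> x Ax; rewrite !funeposE fg.
- exact: measurable_funeneg.
- by move=> x Ax; rewrite !funenegE fg.
Qed.

End ae_nonmeasurable.

(** * First passage of continuous paths *)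

Section first_passage.
Context (R : realType) (d : measure_display) (Omega : measurableType d).
Implicit Types (S : set R) (X : R -> Omega -> R).

Lemma ereal_inf_attained S : closed S -> S !=set0 -> has_lbound S ->
  exists2 t, S t & ereal_inf [set x%:E | x in S] = t%:E.
Proof.
move=> cS S0 lS; exists (inf S); last by rewrite ereal_inf_EFin.
apply: cS => B /nbhs_ballP[e /= e0 eB].
have [x Sx xe] := inf_adherent e0 (conj S0 lS).
exists x; split=> //; apply: eB; rewrite /ball/= ltr_distlC.
by rewrite xe andbT (lt_le_trans _ (ge_inf lS Sx))// ltrBlDr ltrDl.
Qed.

(** Even reflection extends a path from the half-line to all of [R], where preimages of closed and
    open sets are closed and open. *)
Lemma continuous_comp_norm (f : R -> R) :
  {within `[0, +oo[, continuous f} -> continuous (fun t : R => f `|t|).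
Proof.
move=> /subspace_continuousP cf x.
apply: (@cvg_comp _ _ _ (Num.norm : R -> R) f _ (within `[0, +oo[ (nbhs `|x|))); last first.
  by apply: cf; rewrite /= in_itv/= normr_ge0.
move=> B wB; have wBx := @norm_continuous _ R x _ wB.
apply: (@filterS _ (nbhs x) _
  (fun t : R => `[0, +oo[%classic `|t| -> B `|t|)) wBx => t; apply.
by rewrite /= in_itv/= normr_ge0.
Qed.

(** Continuity makes the set of times spent at or above [p] closed, so its infimum is attained as
    soon as it is finite. *)
Lemma threshold_time_leP X p w t :
  {within `[0, +oo[, continuous (fun t => X t w)} ->
  (threshold_time X p w <= t%:E)%E <->
  exists s, [/\ 0 <= s, s <= t & p <= X s w].
Proof.
move=> cX; split=> [tt|[s [s0 st ps]]]; last first.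
  by apply: le_trans (_ : (s%:E <= _)%E); [apply: ereal_inf_lbound; exists s|].
pose S := [set t : R | 0 <= t /\ p <= X t w].
have cS : closed S.
  rewrite (_ : S = [set t : R | 0 <= t] `&` [set t | p <= X `|t| w]); last first.
    by apply/seteqP; split=> u /= [u0]; rewrite ger0_norm.
  apply: closedI; first exact: closed_ge.
  apply: (@preimage_closed _ _ (fun t => X `|t| w) [set x | p <= x]).
    by move=> u _; exact: (continuous_comp_norm cX).
  exact: closed_ge.
have [S0|] := pselect (S !=set0); last first.
  move=> /set0P/negP/negPn/eqP S0; move: tt.
  by rewrite /threshold_time -/S S0 image_set0 ereal_inf0.
have [|s [s0 ps] sE] := ereal_inf_attained cS S0.
  by exists 0 => u [].
by exists s; split => //; rewrite -lee_fin -sE.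
Qed.

Lemma threshold_time_ge0 X p w : (0 <= threshold_time X p w)%E.
Proof. by apply: le_ereal_inf_tmp => _ [s /= [s0 _] <-]; rewrite lee_fin. Qed.

Lemma threshold_time0 X p w : p <= X 0 w -> threshold_time X p w = 0%:E.
Proof.
move=> p0; apply/eqP; rewrite eq_le threshold_time_ge0 andbT.
by apply: ereal_inf_lbound; exists 0.
Qed.

(** The path is at least [p] at time [t], so the intermediate value theorem yields a time [c <= t]
    at level [p]; minimality of [t] forces [t = c]. *)
Lemma threshold_time_value X p w t :
  {within `[0, +oo[, continuous (fun t => X t w)} -> X 0 w <= p ->
  threshold_time X p w = t%:E -> X t w = p.
Proof.
move=> cX X0p tE.
have t0 : 0 <= t by rewrite -lee_fin -tE threshold_time_ge0.
have first s : 0 <= s -> p <= X s w -> t <= s.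
  move=> s0 ps; rewrite -lee_fin -tE.
  by apply/(threshold_time_leP p s cX); exists s.
have [|s [s0 st ps]] := (threshold_time_leP p t cX).1; first by rewrite tE.
have {s s0 st ps} pt : p <= X t w.
  by rewrite (_ : t = s)//; apply/eqP; rewrite eq_le st first.
have [||c] := @IVT _ (fun t => X t w) 0 t p t0.
- by apply: continuous_subspaceW cX => u /=; rewrite !in_itv/= => /andP[->].
- by rewrite ge_min le_max X0p pt orbT.
rewrite in_itv/= => /andP[c0 ct] Xc.
by rewrite (_ : t = c)//; apply/eqP; rewrite eq_le ct first// Xc.
Qed.

Lemma hitting_timeE X p w :
  {within `[0, +oo[, continuous (fun t => X t w)} -> X 0 w <= p ->
  hitting_time X p w = threshold_time X p w.
Proof.
move=> cX X0p; apply/eqP; rewrite eq_le; apply/andP; split; last first.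
  by apply: le_ereal_inf => _ [s [s0 Xs] <-]; exists s => //; rewrite /= Xs.
have := threshold_time_ge0 X p w.
case tE : (threshold_time X p w) => [t| |]// t0; last by rewrite leey.
apply: ereal_inf_lbound; exists t => //; split => //.
exact: threshold_time_value tE.
Qed.

(** Reduces measurability of hitting times to that of threshold times, for another continuous
    process. *)
Lemma hitting_time_threshold X p :
  hitting_time X p = threshold_time (fun t w => - `|X t w - p|) 0.
Proof.
apply/funext => w; congr (ereal_inf (image _ _)).
apply/seteqP; split => t /= [t0 Xt]; split => //.
  by rewrite Xt subrr normr0 oppr0.
by move: Xt; rewrite oppr_ge0 normr_le0 subr_eq0 => /eqP.
Qed.

End first_passage.

(* By continuity X reaches p before t iff it exceeds p - 1/n there at some
   rational time, for every n. *)
Lemma measurable_threshold_time (R : realType) (d : measure_display)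
    (Omega : measurableType d) (X : R -> Omega -> R) (p : R) :
  (forall t, 0 <= t -> measurable_fun setT (X t)) ->
  (forall w, {within `[0, +oo[, continuous (fun t => X t w)}) ->
  measurable_fun setT (threshold_time X p).
Proof.
move=> mX cX.
(* Reflecting and clipping sends every rational into [[0, t]], so that the union below can run over
   all of [rat]. *)
pose m (t : R) (q : rat) : R := Num.min `|ratr q| t.
have m0 (t : R) q : 0 <= t -> 0 <= m t q.
  by move=> t0; rewrite le_min normr_ge0 t0.
have threshold_timeE (t : R) : 0 <= t ->
    [set w | (threshold_time X p w <= t%:E)%E] =
    \bigcap_n \bigcup_q [set w | p - n.+1%:R^-1 < X (m t q) w].
  move=> t0; apply/seteqP; split=> w /=.
    move/(threshold_time_leP p t (cX w)) => [s [s0 st ps]] n _.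
    (* Open in [R] and containing [s], hence containing a rational. The outer norm only serves to
       apply [continuous_comp_norm]. *)
    pose A := [set u : R | p - n.+1%:R^-1 < X `|Num.min `|u| t| w].
    have oA : open A.
      apply: (@open_comp _ _ (fun u : R => X `|Num.min `|u| t| w)
                [set x | p - n.+1%:R^-1 < x]).
        move=> u _.
        apply: (@continuous_comp _ _ _ (fun u : R => Num.min `|u| t)
                  (fun u : R => X `|u| w)).
          apply: (@continuous_min _ _ (Num.norm : R -> R) (cst t)).
            exact: norm_continuous.
          exact: cst_continuous.
        exact: (continuous_comp_norm (cX w)).
      exact: open_gt.
    have [|_ [/[swap] -[q _ <-]]] := @dense_rat R A _ oA.
      exists s; rewrite /A/= (ger0_norm s0) min_l// ger0_norm//.
      by rewrite (lt_le_trans _ ps)// ltrBlDr ltrDl invr_gt0.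
    by rewrite /A/= => Aq; exists q => //=; rewrite -[m t q]ger0_norm// m0.
  move=> H; apply/(threshold_time_leP p t (cX w)).
  have [|s] := @EVT_max R (fun t => X t w) 0 t t0.
    by apply: continuous_subspaceW (cX w) => u /=; rewrite !in_itv/= => /andP[->].
  rewrite in_itv/= => /andP[s0 st] smax; exists s; split => //.
  (* If the maximum over [[0, t]] were below [p], the gap [p - X s w] would exceed some [1/(n+1)],
     and no clipped rational time could serve that [n]. *)
  rewrite leNgt; apply/negP => sp.
  have e0 : 0 < p - X s w by rewrite subr_gt0.
  have [n _ /(_ n (leqnn n)) /= ne] := near_infty_natSinv_lt (PosNum e0).
  have [q _ /=] := H n I.
  apply/negP; rewrite -leNgt (le_trans (smax _ _))//.
    by rewrite in_itv/= m0//= ge_min lexx orbT.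
  by rewrite lerBrDr -lerBrDl ltW.
apply: (measurability _ (ErealGenOInfty.measurableE R)) => _ [_ [t ->] <-].
rewrite setTI preimage_itvoy.
rewrite (_ : [set _ | _] = ~` [set w | (threshold_time X p w <= t%:E)%E]); last first.
  by apply/seteqP; split => w /=; rewrite ltNge => /negP.
apply: measurableC; have [t0|t0] := leP 0 t; last first.
  rewrite (_ : [set _ | _] = set0)// -subset0 => w /=; apply/negP.
  by rewrite -ltNge (lt_le_trans _ (threshold_time_ge0 _ _ _)).
rewrite threshold_timeE//; apply: bigcapT_measurable => n.
apply: bigcupT_measurable_rat => q.
rewrite -preimage_itvoy -[X in measurable X]setTI.
by apply: mX; [exact: m0| |exact: measurable_itv].
Qed.

Lemma measurable_discount (R : realType) (rho : R) :
  measurable_fun setT (discount rho).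
Proof.
rewrite (_ : discount rho =
    fun x => if x \is a fin_num then expR (- (rho * fine x)) else 0); last first.
  by apply/funext; case.
apply: measurable_fun_ifT => //.
  apply: (measurable_fun_bool true).
  exact: (emeasurable_fin_num measurableT (@measurable_id _ _ _)).
apply: measurableT_comp => //; apply: measurableT_comp => //.
by apply: measurable_funM => //; exact: fine_measurable.
Qed.

(** * The value of a threshold *)

Section threshold_payoff.
Context (R : realType) (d : measure_display) (Omega : measurableType d)
  (l r : \bar R) (D : set R) (a sigma : R -> R)
  (P : R -> probability Omega R) (X : R -> Omega -> R)
  (hX : regular_diffusion l r D a sigma P X) (g : R -> R) (rho : R).

(** Under [P x] the event [X 0 = x] has probability one, so a possibly non-measurable pay-off may be
    replaced by a measurable one that agrees with it there. *)
Lemma expectation_start (x : R) (f f' : Omega -> R) :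
  open_itv l r x -> measurable_fun setT f' ->
  (forall w, X 0 w = x -> f w = f' w) -> ('E_(P x)[f] = 'E_(P x)[f'])%E.
Proof.
move=> lxr mf ff'; have [_ lrD _] := diffusion_interval hX.
have mA : measurable [set w | X 0 w = x].
  rewrite -[X in measurable X]setTI.
  exact: (diffusion_measurable hX (lexx 0) measurableT (measurable_set1 x)).
rewrite unlock; apply: (nonmeasurable_integral_eq mA) => //.
- rewrite -[LHS]/(P x (~` _)) probability_setC// (diffusion_start hX) ?subee//.
  exact: lrD.
- exact/measurable_EFinP.
- by move=> w; rewrite inE /= => /ff' ->.
Qed.

Lemma expected_payoff_stop (x p : R) : open_itv l r x -> p <= x ->
  expected_payoff rho g P X x (threshold_time X p) = (g x)%:E.
Proof.
move=> lxr px; rewrite /expected_payoff (@expectation_start x _ (cst (g x)))//.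
  exact: expectation_cst.
by move=> w X0; rewrite threshold_time0 ?X0//= mulr0 oppr0 expR0 mulr1.
Qed.

Lemma expected_payoff_wait (psi : R -> R) (x p : R) :
  increasing_fundamental_solution l r a sigma rho P X psi ->
  open_itv l r x -> open_itv l r p -> x < p ->
  expected_payoff rho g P X x (threshold_time X p) = (g p / psi p * psi x)%:E.
Proof.
move=> hpsi lxr lpr xp.
have cX := diffusion_continuous hX.
pose Z w := discount rho (hitting_time X p w).
have mZ : measurable_fun setT Z.
  apply: measurableT_comp; first exact: measurable_discount.
  rewrite hitting_time_threshold; apply: measurable_threshold_time.
    move=> t t0; apply: measurableT_comp => //; apply: measurableT_comp => //.
    by apply: measurable_funB => //; exact: (diffusion_measurable hX).
  move=> w; apply: (@within_continuous_comp _ _ _ _ (X^~ w)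
    (fun y => - `|y - p|)) => //.
  move=> y _; apply: cvgN; apply: cvg_norm; apply: cvgB; first exact: cvg_id.
  exact: cvg_cst.
have EZ : ('E_(P x)[Z] = (psi x / psi p)%:E)%E := fundamental_hitting hpsi lxr lpr xp.
have iZ : (P x).-integrable setT (EFin \o Z).
  apply/integrableP; split; first exact/measurable_EFinP.
  (* Since [Z] is nonnegative, its integrability amounts to finiteness of its expectation, which is
     the known quotient. *)
  rewrite (_ : (fun _ => _) = EFin \o Z); last first.
    apply/funext => w /=; rewrite ger0_norm// /Z.
    by case: hitting_time => //= t; exact: expR_ge0.
  by move: EZ; rewrite unlock => ->; rewrite ltry.
rewrite /expected_payoff (@expectation_start x _ (fun w => g p * Z w))//.
- move: EZ; rewrite unlock => EZ; under eq_integral do rewrite EFinM.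
  rewrite integralZl// EZ -EFinM; congr (_%:E); rewrite mulrA mulrAC -!mulrA.
  by congr (_ * _); exact: mulrC.
- exact: measurable_funM.
- move=> w X0; have X0p : X 0 w <= p by rewrite X0 ltW.
  rewrite /Z hitting_timeE//.
  (* If the threshold is never reached, [fine] returns the default time 0 and [g] is evaluated at
     [X 0 w], but the zero discount cancels this value on both sides. *)
  case tE : (threshold_time X p w) => [t| |]; rewrite /= ?mulr0//.
  by rewrite (threshold_time_value (cX w) X0p tE).
Qed.

Lemma expected_payoff_threshold (psi : R -> R) (x p : R) :
  increasing_fundamental_solution l r a sigma rho P X psi ->
  open_itv l r x -> open_itv l r p ->
  expected_payoff rho g P X x (threshold_time X p) =
  (g (Num.max x p) / psi (Num.max x p) * psi x)%:E.
Proof.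
move=> hpsi lxr lpr; have [px|xp] := leP p x.
  rewrite expected_payoff_stop// mulfVK// gt_eqF//.
  exact: fundamental_gt0 hpsi _ lxr.
exact: expected_payoff_wait.
Qed.

End threshold_payoff.

Theorem theorem2 (R : realType) (d : measure_display) (Omega : measurableType d)
    (l r : \bar R) (D : set R) (a sigma : R -> R)
    (P : R -> probability Omega R) (X : R -> Omega -> R)
    (hX : regular_diffusion l r D a sigma P X)
    (g : R -> R) (hg : exists2 x0, open_itv l r x0 & 0 < g x0)
    (rho : R) (hrho : 0 < rho)
    (psi : R -> R)
    (hpsi : increasing_fundamental_solution l r a sigma rho P X psi)
    (pstar : R) (hpstar : open_itv l r pstar) :
  let h := fun p : R => g p / psi p in
  (forall x, open_itv l r x ->
     optimal_in (threshold_times l r X) rho g P X x (threshold_time X pstar))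
  <->
  (forall p, open_itv l r p -> p < pstar -> h p <= h pstar) /\
  (forall p q, open_itv l r p -> open_itv l r q ->
     pstar <= p -> p <= q -> h q <= h p).
Proof.
move=> h.
have payoff x p : open_itv l r x -> open_itv l r p ->
    expected_payoff rho g P X x (threshold_time X p) =
    (h (Num.max x p) * psi x)%:E.
  by move=> lxr lpr; rewrite (expected_payoff_threshold hX _ hpsi).
have optimalP x : open_itv l r x ->
    optimal_in (threshold_times l r X) rho g P X x (threshold_time X pstar) <->
    forall p, open_itv l r p -> h (Num.max x p) <= h (Num.max x pstar).
  move=> lxr; have psix := fundamental_gt0 hpsi lxr; split.
    move=> [_ opt] p lpr; rewrite -(ler_pM2r psix) -lee_fin -!payoff// opt.
    by apply: ereal_sup_ubound; exists (threshold_time X p) => //; exists p.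
  move=> hmax; split; first by exists pstar.
  apply/eqP; rewrite eq_le; apply/andP; split.
    apply: ereal_sup_ubound; exists (threshold_time X pstar) => //.
    by exists pstar.
  apply: ge_ereal_sup => _ [_ [p lpr <-] <-].
  by rewrite !payoff// lee_fin ler_pM2r// hmax.
split=> [opt|[h1 h2] x lxr].
  split=> [p lpr ppstar|p q lpr lqr pstarp pq].
    by have /optimalP -/(_ lpr p lpr) := opt p lpr; rewrite maxxx max_r// ltW.
  by have /optimalP -/(_ lpr q lqr) := opt p lpr; rewrite max_r// max_l.
apply/optimalP => // p lpr.
have lmr : open_itv l r (Num.max x p) by rewrite maxEle; case: ifP.
(* If [max x p < pstar], then [max x pstar] is [pstar] and the first condition applies at [max x p].
   Otherwise [pstar <= max x pstar <= max x p] and the second one applies. *)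
have [pstarm|mpstar] := leP pstar (Num.max x p); last first.
  rewrite (@max_r _ _ x pstar) ?h1//.
  by move: mpstar; rewrite gt_max => /andP[/ltW].
apply: h2 => //; first by rewrite maxEle; case: ifP.
  by rewrite le_max lexx orbT.
by rewrite ge_max le_max lexx pstarm.
Qed.
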